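(* Let $n\ge3$, let $\lambda_0,\ldots,\lambda_{n-1}\in\mathbb{R}$, and suppose that $P^\lambda$ is the transition matrix of an involutive walk on $\{0,\ldots,n-1\}$ in which $0$ is accessible from every state. Then $P^\lambda$ is globally reversible if and only if one of the following holds: - $P^\lambda=P(\gamma^{(a,b)})$ for unique $a,b\in\mathbb{R}$ with $a,b>-1$; or - $P^\lambda=P(\gamma^{(c)})$ for a unique $c\in\mathbb{R}$ with $c>0$; or - $P^\lambda=P(\delta^{(a',b')})$ for unique $a',b'$ with $a'\in\mathbb{R}$, $a'>n-1$, and either $b'\in\mathbb{R}$ with $b'>n-1$, or $b'\in\mathbb{N}$ with $b'\ge2$.
   Context: Rows and columns of matrices are numbered from $0$. Let $B(n)_{xy}=\binom{x}{y}$ be the $n\times n$ Pascal matrix, and $J(n)$ the $n\times n$ matrix with $J(n)_{xy}=1$ if $x+y=n-1$ and $0$ otherwise. Define $H^\lambda=B(n)\,\mathrm{Diag}(\lambda_0,\ldots,\lambda_{n-1})\,B(n)^{-1}$ and $P^\lambda=H^\lambda J(n)$. An involutive walk on $\{0,\ldots,n-1\}$ is a Markov chain in which from state $x$ one chooses $y\in\{0,\ldots,x\}$ according to some probability distribution depending on $x$ and then steps to $n-1-y$; equivalently its transition matrix $P$ is stochastic with $P_{xz}=0$ whenever $x+z<n-1$. The walk is reversible if there is a strictly positive probability distribution $\pi$ with $\pi_xP_{xz}=\pi_zP_{zx}$ for all $x,z$. The transition matrix $P$ of an involutive walk on $\{0,\ldots,n-1\}$ is globally reversible if for every $1\le m\le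 n$ the top-right $m\times m$ submatrix of $P$ (rows $0,\ldots,m-1$, columns $n-m,\ldots,n-1$, relabelled $0,\ldots,m-1$) is the transition matrix of a reversible involutive walk on $\{0,\ldots,m-1\}$. Binomial coefficients are $\binom{r}{d}=r(r-1)\cdots(r-d+1)/d!$ for $r\in\mathbb{R}$, $d\in\mathbb{N}_0$. For $0\le y\le x\le n-1$ define $\gamma^{(a,b)}_{[y,x]}=\binom{y+a}{y}\binom{b+x-y}{x-y}$, $\gamma^{(c)}_{[y,x]}=\binom{x}{y}c^{x-y}$ and $\delta^{(a',b')}_{[y,x]}=\binom{a'-1}{y}\binom{b'-1}{x-y}$. For each such function $\gamma$, $P(\gamma)$ is the $n\times n$ matrix with $P(\gamma)_{xz}=\gamma_{[n-1-z,x]}/\sum_{y=0}^x\gamma_{[y,x]}$ if $x+z\ge n-1$ and $P(\gamma)_{xz}=0$ otherwise. *)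

(* Defs.v *)
From mathcomp Require Import all_boot all_order all_algebra.
From mathcomp Require Import reals.

Set Implicit Arguments.
Unset Strict Implicit.
Unset Printing Implicit Defensive.

Import Order.TTheory GRing.Theory Num.Theory.
Local Open Scope ring_scope.

Section Matrices.
Variable R : realType.

(* The matrix is unitriangular, so [invmx] below is its genuine inverse. *)
Definition pascal_mx (n : nat) : 'M[R]_n := \matrix_(x, y) 'C(x, y)%:R.

Definition antidiag_mx (n : nat) : 'M[R]_n :=
  \matrix_(x, y) (x + y == n.-1)%N%:R.

Definition H_mx (n : nat) (lam : 'rV[R]_n) : 'M[R]_n :=
  pascal_mx n *m diag_mx lam *m invmx (pascal_mx n).

Definition P_mx (n : nat) (lam : 'rV[R]_n) : 'M[R]_n :=
  H_mx lam *m antidiag_mx n.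

End Matrices.

Section Walks.
Variable R : realType.

Definition stochastic (n : nat) (P : 'M[R]_n) : Prop :=
  (forall x z, 0 <= P x z) /\ (forall x, \sum_z P x z = 1).

Definition involutive_walk (n : nat) (P : 'M[R]_n) : Prop :=
  stochastic P /\ forall x z : 'I_n, (x + z < n.-1)%N -> P x z = 0.

Definition accessible (n : nat) (P : 'M[R]_n) (x z : 'I_n) : Prop :=
  exists k : nat, 0 < (P ^+ k) x z.

Definition reversible (n : nat) (P : 'M[R]_n) : Prop :=
  exists pi : 'I_n -> R,
    [/\ forall x, 0 < pi x,
        \sum_x pi x = 1
      & forall x z, pi x * P x z = pi z * P z x].

(* Column [j] of the submatrix is column [n - m + j] of [P]. *)
Definition topright_mx (m n : nat) (le_mn : (m <= n)%N) (P : 'M[R]_n) :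
    'M[R]_m :=
  \matrix_(i, j) P (widen_ord le_mn i) (cast_ord (subnK le_mn) (rshift (n - m) j)).

Definition globally_reversible (n : nat) (P : 'M[R]_n) : Prop :=
  forall (m : nat) (le_mn : (m <= n)%N), (1 <= m)%N ->
    involutive_walk (topright_mx le_mn P) /\ reversible (topright_mx le_mn P).

End Walks.

Section Weights.
Variable R : realType.

Definition binr (r : R) (d : nat) : R :=
  (\prod_(i < d) (r - i%:R)) / d`!%:R.

(* A weight [g] is applied as [g y x], and is only used for [y <= x]. *)
Definition gamma_ab (a b : R) (y x : nat) : R :=
  binr (y%:R + a) y * binr (b + (x - y)%:R) (x - y).

Definition gamma_c (c : R) (y x : nat) : R := 'C(x, y)%:R * c ^+ (x - y).

Definition delta_ab (a' b' : R) (y x : nat) : R :=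
  binr (a' - 1) y * binr (b' - 1) (x - y).

Definition weight_mx (n : nat) (g : nat -> nat -> R) : 'M[R]_n :=
  \matrix_(x, z)
    if (n.-1 <= x + z)%N
    then g (n.-1 - z)%N x / \sum_(y < x.+1) g y x
    else 0.

End Weights.

(* Main.v *)
(* Write f(y,d) for the d-th backward difference of lambda at y, so that
   H_xy = C(x,y) f(y,x-y).  Global reversibility, tested on the four states
   1, 2, m-2, m-1 of the top-right m x m submatrix, gives an equation that
   determines lambda_(m-1) from earlier entries.  With p = lambda_1, q = 1 - p
   and t fixed by lambda_2, it forces lambda_k to be the product of the
   (p + i t) / (1 + i t) over i < k, the moments of a Polya urn, and hence
     f(y,d) = prod_(i<y) (p + i t) prod_(i<d) (q + i t) / prod_(i<y+d) (1 + i t).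
   The cases t > 0, t = 0, t < 0 are the weights gamma^(a,b), gamma^(c),
   delta^(a',b').  Conversely, if H_xy = A_y B_(x-y) C_x, then
   pi_x = A_(m-1-x) / C_x satisfies detailed balance. *)

Require Import Defs.
From mathcomp Require Import all_boot all_order all_algebra.
From mathcomp Require Import reals.
From mathcomp Require Import zify ring lra.

Set Implicit Arguments.
Unset Strict Implicit.
Unset Printing Implicit Defensive.

Import Order.TTheory GRing.Theory Num.Theory.
Local Open Scope ring_scope.

(** * Finite differences, and the entries of [H_mx] and [P_mx] *)

Lemma mul_bin_bin n m k : (k <= m <= n)%N ->
  ('C(n, m) * 'C(m, k) = 'C(n, k) * 'C(n - k, m - k))%N.
Proof.
move=> /andP[km mn]; have kn := leq_trans km mn.
have F := fact_gt0.
apply/eqP; rewrite -(eqn_pmul2r (F k)) -(eqn_pmul2r (F (m - k)%N)).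
rewrite -(eqn_pmul2r (F (n - m)%N)); apply/eqP.
have E1 := bin_fact km; have E2 := bin_fact mn; have E3 := bin_fact kn.
have E4 : ('C(n - k, m - k) * ((m - k)`! * (n - m)`!) = (n - k)`!)%N.
  by rewrite -(@bin_fact (n - k) (m - k)) ?leq_sub2r // subnBA // subnK.
transitivity n`!; first by rewrite -E2 -E1; ring.
by rewrite -E3 -E4; ring.
Qed.

Section Differences.
Variable R : realType.
Implicit Types (l : nat -> R) (p t : R).

(** With this sign, [fdiff l y d] is the sum of $(-1)^i\binom{d}{i}\,l(y+i)$ over $i\le d$. *)
Fixpoint fdiff l (y d : nat) : R :=
  if d is d'.+1 then fdiff l y d' - fdiff l y.+1 d' else l y.

Definition step_wt l (x y : nat) : R := 'C(x, y)%:R * fdiff l y (x - y).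

Lemma step_wt_gt l x y : (x < y)%N -> step_wt l x y = 0.
Proof. by move=> xy; rewrite /step_wt bin_small // mul0r. Qed.

Lemma step_wt_diag l x : step_wt l x x = l x.
Proof. by rewrite /step_wt binn subnn mul1r. Qed.

Lemma step_wt_subdiag l x : step_wt l x.+1 x = x.+1%:R * (l x - l x.+1).
Proof. by rewrite /step_wt binSn subSnn. Qed.

(** For the shift $E$ and the difference $D=1-E$, this is $(E+D)^d=1$ expanded by the binomial
    theorem. *)
Lemma sum_fdiff l k e d :
  \sum_(j < d.+1) 'C(d, j)%:R * fdiff l (k + j) (e + (d - j)) = fdiff l k e.
Proof.
elim: d k e => [|d IH] k e.
  by rewrite big_ord_recl big_ord0 /= bin0 mul1r !addn0 addr0.
rewrite -(IH k e) big_ord_recl /= bin0 mul1r addn0.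
transitivity (fdiff l k (e + d.+1) +
  (\sum_(i < d.+1) 'C(d, i.+1)%:R * fdiff l (k + i.+1) (e + (d - i))
  + \sum_(i < d.+1) 'C(d, i)%:R * fdiff l (k + i.+1) (e + (d - i)))).
  rewrite -big_split /=; congr (_ + _).
  by apply: eq_bigr => i _; rewrite /bump /= add1n binS subSS natrD mulrDl.
have -> : fdiff l k (e + d.+1) +
    (\sum_(i < d.+1) 'C(d, i.+1)%:R * fdiff l (k + i.+1) (e + (d - i))
    + \sum_(i < d.+1) 'C(d, i)%:R * fdiff l (k + i.+1) (e + (d - i))) =
  \sum_(i < d.+1) 'C(d, i)%:R * fdiff l (k + i) (e + (d.+1 - i))
    + \sum_(i < d.+1) 'C(d, i)%:R * fdiff l (k + i.+1) (e + (d - i)).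
  rewrite addrA; congr (_ + _).
  rewrite big_ord_recr [RHS]big_ord_recl /= bin_small // mul0r addr0.
  rewrite bin0 mul1r addn0 subn0; congr (_ + _).
rewrite -big_split /=; apply: eq_bigr => i _.
have le_id : (i <= d)%N by rewrite -ltnS.
by rewrite -mulrDr subSn // !addnS /= subrK.
Qed.

(** Entry $(x,k)$ of $HB=B\,\mathrm{Diag}(\lambda)$. Only $k\le y\le x$ contributes; there $\binom
    xy\binom yk=\binom xk\binom{x-k}{y-k}$ reduces the sum to [sum_fdiff]. *)
Lemma sum_step_wt_bin l x k n : (x < n)%N ->
  \sum_(y < n) step_wt l x y * 'C(y, k)%:R = 'C(x, k)%:R * l k.
Proof.
move=> ltxn; have [xk|kx] := ltnP x k.
  rewrite bin_small // mul0r big1 // => y _.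
  have [xy|yx] := ltnP x y; first by rewrite step_wt_gt // mul0r.
  by rewrite [X in _ * X%:R]bin_small ?mulr0 //; apply: leq_ltn_trans xk.
pose F y : R := step_wt l x y * 'C(y, k)%:R.
rewrite -(big_mkord predT F) (big_cat_nat (n := k)) /=; last 2 first; try lia.
rewrite big_nat_cond big1 ?add0r; last first.
  by move=> i /andP[/andP[_ ik] _]; rewrite /F bin_small // mulr0.
rewrite (big_cat_nat (n := x.+1)) /=; last 2 first; try lia.
rewrite [X in _ + X]big_nat_cond [X in _ + X]big1 ?addr0; last first.
  by move=> i /andP[/andP[xi _] _]; rewrite /F step_wt_gt // mul0r.
rewrite -{1}[k]add0n big_addn subSn // big_mkord.
rewrite -[l k]/(fdiff l k 0) -(sum_fdiff l k 0 (x - k)) mulr_sumr.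
apply: eq_bigr => j _; rewrite /F /step_wt add0n.
have jx : (j <= x - k)%N by rewrite -ltnS.
have -> : (x - (j + k) = x - k - j)%N by lia.
rewrite [(k + j)%N]addnC mulrAC [RHS]mulrA; congr (_ * _).
rewrite -!natrM mul_bin_bin ?addnK //; lia.
Qed.


Lemma sum_step_wt_small l x n : (x < n)%N ->
  \sum_(y < n) step_wt l x y = l 0%N.
Proof.
move=> xn; have := sum_step_wt_bin l 0 xn; rewrite bin0 mul1r => <-.
by apply: eq_bigr => y _; rewrite bin0 mulr1.
Qed.

(** Indexing by [nat] lets differences be formed without bound proofs; for [k > N], [inord] falls
    back to index 0. *)
Definition lam_fun N (lam : 'rV[R]_N.+1) (k : nat) : R := lam 0 (inord k).

Lemma pascal_mx_unit N : pascal_mx R N \in unitmx.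
Proof.
rewrite unitmxE det_trig.
  by rewrite big1 ?unitr1 // => i _; rewrite mxE binn.
by apply/is_trig_mxP => i j ij; rewrite mxE bin_small.
Qed.

Lemma H_mxE N (lam : 'rV[R]_N.+1) x y :
  H_mx lam x y = step_wt (lam_fun lam) x y.
Proof.
have -> : H_mx lam = \matrix_(x, y) step_wt (lam_fun lam) x y; last by rewrite mxE.
apply: (can_inj (mulmxK (pascal_mx_unit N.+1))).
rewrite /H_mx mulmxKV ?pascal_mx_unit //; apply/matrixP => i k.
rewrite mul_mx_diag !mxE.
under eq_bigr do rewrite !mxE.
by rewrite sum_step_wt_bin // /lam_fun inord_val.
Qed.

Lemma P_mxE N (lam : 'rV[R]_N.+1) x z :
  P_mx lam x z = step_wt (lam_fun lam) x (N - z).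
Proof.
rewrite !mxE (bigD1 (rev_ord z)) //= big1 => [|y ny].
  rewrite addr0 H_mxE !mxE /= subSS subnK ?eqxx ?mulr1 //.
  by rewrite -ltnS.
rewrite [X in _ * X]mxE /=; case: eqP => [yz|]; rewrite ?mulr0 //.
case/eqP: ny; apply/val_inj => /=; lia.
Qed.

(** The shift of columns absorbs the change of size: the block is built from the same step weights,
    so one sequence $\lambda$ governs every [m]. *)
Lemma topright_P_mxE N (lam : 'rV[R]_N.+1) m (le_mN : (m <= N.+1)%N) i j :
  topright_mx le_mN (P_mx lam) i j = step_wt (lam_fun lam) i (m.-1 - j).
Proof.
rewrite mxE P_mxE /=; congr (step_wt _ _ _).
have := ltn_ord j; lia.
Qed.

Lemma weight_mxE N (lam : 'rV[R]_N.+1) g :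
  P_mx lam = weight_mx N.+1 g <->
  (forall x y, (y <= x <= N)%N ->
    step_wt (lam_fun lam) x y = g y x / \sum_(i < x.+1) g i x).
Proof.
split=> [E x y /andP[yx xN]|E].
  have := congr1 (fun M : 'M_N.+1 => M (inord x) (inord (N - y))) E.
  rewrite P_mxE mxE !inordK; try lia.
  have -> : (N - (N - y) = y)%N by lia.
  by rewrite ifT //=; lia.
apply/matrixP => x z; rewrite P_mxE mxE /=.
have zN := ltn_ord z; have xN := ltn_ord x.
case: ifP => xz; first by rewrite E //; lia.
by rewrite step_wt_gt //; lia.
Qed.

(** * Row sums and signs of the step weights *)

Lemma lam_fun0 N (lam : 'rV[R]_N.+1) : stochastic (P_mx lam) -> lam_fun lam 0 = 1.
Proof.
case=> _ /(_ ord0) <-; rewrite -(sum_step_wt_small (lam_fun lam) (ltn0Sn N)).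
rewrite (reindex_inj rev_ord_inj); apply: eq_bigr => z _.
by rewrite P_mxE /= subSS.
Qed.

Lemma step_wt_ge0 N (lam : 'rV[R]_N.+1) x y :
  stochastic (P_mx lam) -> (x <= N)%N -> 0 <= step_wt (lam_fun lam) x y.
Proof.
move=> [P0 _] xN; have [xy|yx] := ltnP x y; first by rewrite step_wt_gt.
have := P0 (inord x) (inord (N - y)).
rewrite P_mxE !inordK ?subKn //; lia.
Qed.

Lemma topright_involutive_walk N (lam : 'rV[R]_N.+1) m (le_mN : (m <= N.+1)%N) :
  stochastic (P_mx lam) -> involutive_walk (topright_mx le_mN (P_mx lam)).
Proof.
move=> st; split; last first.
  move=> x z xz; rewrite topright_P_mxE step_wt_gt //; lia.
split=> [x z|x].
  by rewrite topright_P_mxE step_wt_ge0 //; have := ltn_ord x; lia.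
rewrite -(lam_fun0 st) -(sum_step_wt_small (lam_fun lam) (ltn_ord x)).
rewrite (reindex_inj rev_ord_inj); apply: eq_bigr => z _.
rewrite topright_P_mxE /=; congr (step_wt _ _ _); have := ltn_ord z; lia.
Qed.

(** * Weights in product form give globally reversible walks *)

Lemma topright_reversible_of_product N (lam : 'rV[R]_N.+1)
    (A B C : nat -> R) m (le_mN : (m.+1 <= N.+1)%N) :
  (forall k, (k <= N)%N -> 0 < A k) -> (forall k, (k <= N)%N -> 0 < C k) ->
  (forall x y, (y <= x <= N)%N ->
     step_wt (lam_fun lam) x y = A y * B (x - y)%N * C x) ->
  reversible (topright_mx le_mN (P_mx lam)).
Proof.
move=> A0 C0 E; pose w (x : 'I_m.+1) := A (m - x)%N / C x.
have w0 x : 0 < w x.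
  by rewrite divr_gt0 ?A0 ?C0 //; have := ltn_ord x; lia.
pose W := \sum_x w x.
have W0 : 0 < W.
  by rewrite /W (bigD1 ord0) //= ltr_pwDl // sumr_ge0 // => i _; apply: ltW.
exists (fun x => w x / W); split=> [x||x z].
- by rewrite divr_gt0.
- by rewrite -mulr_suml divff // gt_eqF.
rewrite mulrAC [RHS]mulrAC; congr (_ / _).
have xm := ltn_ord x; have zm := ltn_ord z.
rewrite !topright_P_mxE /=; have [xz|xz] := ltnP (x + z) m.
  by rewrite !step_wt_gt ?mulr0 //; lia.
rewrite !E; try lia.
(* [B] is taken at $x+z-m$, which is symmetric in [x] and [z], so only [A] and [C] must be balanced
   by [w]. *)
have -> : (x - (m - z) = z - (m - x))%N by lia.
rewrite /w; field.
by rewrite !gt_eqF ?C0 //; lia.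
Qed.

(** The row normaliser is absorbed into [C]. [B] may vanish away from 0, as happens for
    $\delta^{(a',b')}$ with small integral $b'$; the term $y=x$ keeps the normaliser positive. *)
Lemma globally_reversible_of_weight N (lam : 'rV[R]_N.+1) g (A B C : nat -> R) :
  stochastic (P_mx lam) -> P_mx lam = weight_mx N.+1 g ->
  (forall k, (k <= N)%N -> 0 < A k) -> (forall k, (k <= N)%N -> 0 < C k) ->
  (forall k, (k <= N)%N -> 0 <= B k) -> 0 < B 0%N ->
  (forall x y, (y <= x <= N)%N -> g y x = A y * B (x - y)%N * C x) ->
  globally_reversible (P_mx lam).
Proof.
move=> st /weight_mxE E A0 C0 B0 B00 gE [//|m] le_mN _.
split; first exact: topright_involutive_walk.
pose S x := \sum_(i < x.+1) g i x.
have S0 x : (x <= N)%N -> 0 < S x.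
  move=> xN; rewrite /S big_ord_recr /= ltr_wpDl //; last first.
    by rewrite gE ?subnn ?mulr_gt0 ?A0 ?C0 ?leqnn.
  apply: sumr_ge0 => i _; have ix := ltn_ord i; rewrite gE; last lia.
  by rewrite !mulr_ge0 ?B0 ?(ltW (A0 _ _)) ?(ltW (C0 _ _)) //; lia.
apply: (@topright_reversible_of_product _ _ A B (fun x => C x / S x)) => //.
  by move=> k kN; rewrite divr_gt0 ?C0 ?S0.
by move=> x y yx; rewrite E // gE // -mulrA.
Qed.

Lemma binr_gt0 (r : R) d : (forall i, (i < d)%N -> i%:R < r) -> 0 < binr r d.
Proof.
move=> H; rewrite divr_gt0 ?ltr0n ?fact_gt0 // prodr_gt0 // => i _.
by rewrite subr_gt0 H.
Qed.

Lemma binr_nat_ge0 n d : 0 <= binr (n%:R : R) d.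
Proof.
rewrite divr_ge0 ?ler0n //.
have [dn|nd] := leqP d n.
  by rewrite prodr_ge0 // => i _; rewrite subr_ge0 ler_nat; have := ltn_ord i; lia.
by rewrite (bigD1 (Ordinal nd)) //= subrr mul0r.
Qed.

Lemma gamma_ab_globally_reversible N (lam : 'rV[R]_N.+1) a b :
  stochastic (P_mx lam) -> -1 < a -> -1 < b ->
  P_mx lam = weight_mx N.+1 (gamma_ab a b) -> globally_reversible (P_mx lam).
Proof.
move=> st a1 b1 E.
have pos (c : R) k : -1 < c -> 0 < binr (k%:R + c) k.
  move=> c1; apply: binr_gt0 => i ik.
  have : i.+1%:R <= k%:R :> R by rewrite ler_nat.
  rewrite -natr1; lra.
apply: (@globally_reversible_of_weight _ _ _
  (fun k => binr (k%:R + a) k) (fun k => binr (k%:R + b) k) (fun=> 1) st E).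
- by move=> k _; apply: pos.
- by move=> k _; apply: ltr01.
- by move=> k _; apply/ltW/pos.
- exact: pos.
- by move=> x y _; rewrite mulr1 /gamma_ab [b + _]addrC.
Qed.

Lemma gamma_c_globally_reversible N (lam : 'rV[R]_N.+1) c :
  stochastic (P_mx lam) -> 0 < c ->
  P_mx lam = weight_mx N.+1 (gamma_c c) -> globally_reversible (P_mx lam).
Proof.
move=> st c0 E.
have F k : 0 < k`!%:R :> R by rewrite ltr0n fact_gt0.
apply: (@globally_reversible_of_weight _ _ _ (fun k => (k`!%:R)^-1)
  (fun k => c ^+ k / k`!%:R) (fun k => k`!%:R) st E) => //.
- by move=> k _; rewrite invr_gt0.
- by move=> k _; rewrite divr_ge0 ?exprn_ge0 ?ltW.
- by rewrite expr0 divr_gt0.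
- move=> x y /andP[yx _]; rewrite /gamma_c -(bin_fact yx) !natrM.
  field; by rewrite !gt_eqF.
Qed.

Lemma delta_ab_globally_reversible N (lam : 'rV[R]_N.+1) a b :
  stochastic (P_mx lam) -> N.+1%:R - 1 < a ->
  N.+1%:R - 1 < b \/ (b \is a Num.nat /\ 2 <= b) ->
  P_mx lam = weight_mx N.+1 (delta_ab a b) -> globally_reversible (P_mx lam).
Proof.
move=> st aN bN E.
have pos (c : R) k : N.+1%:R - 1 < c -> (k <= N)%N -> 0 < binr (c - 1) k.
  move=> cN kN; apply: binr_gt0 => i ik.
  have : i.+1%:R <= N%:R :> R by rewrite ler_nat; lia.
  move: cN; rewrite -!natr1; lra.
apply: (@globally_reversible_of_weight _ _ _
  (fun k => binr (a - 1) k) (fun k => binr (b - 1) k) (fun=> 1) st E).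
- by move=> k kN; apply: pos.
- by move=> k _; apply: ltr01.
(* For a natural number [b], [binr (b - 1) k] is 0 as soon as [k] exceeds [b - 1]. *)
- move=> k kN; case: bN => [bN|[/natrP[n bE] b2]]; first exact/ltW/pos.
  have n0 : (0 < n)%N by rewrite -(ltr_nat R) -bE; lra.
  by rewrite bE -[n]prednK // -addn1 natrD addrK binr_nat_ge0.
- by rewrite /binr big_ord0 divr1.
- by move=> x y _; rewrite mulr1.
Qed.

(** * Polya urn moments and their differences *)

Definition rising p t (k : nat) : R := \prod_(i < k) (p + i%:R * t).

Lemma risingS p t k : rising p t k.+1 = rising p t k * (p + k%:R * t).
Proof. by rewrite /rising big_ord_recr. Qed.

Lemma rising_gt0 p t k : (forall i, (i < k)%N -> 0 < p + i%:R * t) -> 0 < rising p t k.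
Proof. by move=> H; rewrite prodr_gt0 // => i _; apply: H. Qed.

(** The induction on [d] rests on $(1+(y+d)t)-(p+yt)=(1-p)+dt$. *)
Lemma fdiff_rising l p t N :
  (forall k, (k <= N)%N -> 0 < rising 1 t k) ->
  (forall k, (k <= N)%N -> l k = rising p t k / rising 1 t k) ->
  forall y d, (y + d <= N)%N ->
  fdiff l y d = rising p t y * rising (1 - p) t d / rising 1 t (y + d).
Proof.
move=> T0 lE y d; elim: d y => [|d IH] y ydN.
  by rewrite addn0 in ydN *; rewrite /= lE // [rising _ _ 0]big_ord0 mulr1.
have T1 := T0 _ ydN; have ydN' : (y + d <= N)%N by lia.
have T2 := T0 _ ydN'.
rewrite /= !IH ?addSn -?addnS // {ydN ydN' IH}.
move: T1; rewrite addnS !risingS => T1.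
have T3 : 1 + (y + d)%:R * t != 0.
  by apply: contraTneq T1 => ->; rewrite mulr0 ltxx.
by rewrite natrD in T3 *; field; rewrite T3 gt_eqF.
Qed.

(** * The recursion forced by detailed balance *)

Lemma reversible_step_wt N (lam : 'rV[R]_N.+1) M :
  globally_reversible (P_mx lam) -> (M <= N)%N ->
  exists2 w : nat -> R, (forall x, 0 < w x) &
    forall x z, (x <= M)%N -> (z <= M)%N ->
    w x * step_wt (lam_fun lam) x (M - z) = w z * step_wt (lam_fun lam) z (M - x).
Proof.
move=> glob MN; have [_ [w [w0 _ wE]]] := glob M.+1 MN isT.
exists (fun k => w (inord k)) => // x z xM zM.
by have := wE (inord x) (inord z); rewrite !topright_P_mxE !inordK.
Qed.

(** Balance between states 1 and $k+1$ in the block of size $k+2$ makes $\lambda_0-\lambda_1$ a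
    positive multiple of $\lambda_k-\lambda_{k+1}$. *)
Lemma lam_fun_decr N (lam : 'rV[R]_N.+1) k :
  globally_reversible (P_mx lam) -> (k < N)%N ->
  (lam_fun lam k.+1 < lam_fun lam k) = (lam_fun lam 1 < lam_fun lam 0).
Proof.
move=> glob kN; have [w w0 /(_ 1%N k.+1 isT (leqnn _))] := reversible_step_wt glob kN.
rewrite subnn subn1 step_wt_subdiag step_wt_subdiag => E.
rewrite -subr_gt0 -[RHS]subr_gt0.
rewrite -(pmulr_rgt0 _ (ltr0Sn R k)) -(pmulr_rgt0 _ (w0 k.+1)) -E.
by rewrite mul1r pmulr_rgt0.
Qed.

(* Detailed balance along the closed path M, 1, M - 1, 2, M with M = K + 2. *)
Lemma four_cycle N (lam : 'rV[R]_N.+1) K :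
  let l := lam_fun lam in
  globally_reversible (P_mx lam) -> (K.+2 <= N)%N -> 0 < l K.+1 ->
  fdiff l 0 2 * l 1%N * (l K - l K.+1) * (l K.+1 - l K.+2) =
  (l 0%N - l 1%N) * l K.+1 * (l 1%N - l 2) * (l K - l K.+1 - (l K.+1 - l K.+2)).
Proof.
move=> l glob KN l0; have [w w0 E] := reversible_step_wt glob KN.
have := E 1%N K.+2; have := E 1%N K.+1; have := E 2 K.+2; have := E 2 K.+1.
rewrite !subSS !subn0 subnn -/l => /(_ isT (leqnSn _)) E4.
move=> /(_ isT (leqnn _)) E3 /(_ isT (leqnSn _)) E2 /(_ isT (leqnn _)) E1.
rewrite subSnn !step_wt_diag in E2; rewrite subSnn in E4.
rewrite !step_wt_subdiag mul1r in E1.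
rewrite !step_wt_subdiag in E4.
have C2 : 2 * 'C(K.+2, K)%:R = K.+2%:R * K.+1%:R :> R.
  have <- : 'C(K.+2, 2) = 'C(K.+2, K) by rewrite -bin_sub // subSS subn1.
  by rewrite -!natrM mul_bin_left bin1 subn1 mulnC.
rewrite /step_wt bin0 mul1r subn0 subSn // subSn // subnn in E3.
rewrite -[fdiff l K 2]/(l K - l K.+1 - (l K.+1 - l K.+2)) in E3.
set s := fdiff l 0 2 in E3 *; set u := l K - _ in E3 E4 *.
set v := l K.+1 - _ in E1 E3 *; set q := l 0%N - _ in E1 *.
set o := l 1%N - _ in E4 *.
have nz : w K.+2 * (K.+2%:R * K.+1%:R) != 0 by rewrite !mulf_neq0 ?pnatr_eq0 ?gt_eqF.
(* Each balance equation trades the weight of one state for that of the next on the path, until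
   [w K.+2] returns and cancels. *)
apply: (mulfI nz).
transitivity (K.+1%:R * s * l 1%N * u * (w K.+2 * (K.+2%:R * v))); first ring.
rewrite -E1.
transitivity (K.+1%:R * s * u * q * (w 1%N * l 1%N)); first ring.
rewrite E2.
transitivity (s * l K.+1 * q * (w K.+1 * (K.+1%:R * u))); first ring.
rewrite -E4.
transitivity (2 * o * l K.+1 * q * (w 2 * s)); first ring.
transitivity (q * l K.+1 * o * (u - v) * w K.+2 * (2 * 'C(K.+2, K)%:R)).
  by rewrite E3; ring.
by rewrite C2; ring.
Qed.

(** The last hypothesis is the case [k = 1] and fixes [t]; [four_cycle] carries the relation from
    [K] to [K.+1]. *)
Lemma polya_recursion N (lam : 'rV[R]_N.+1) t :
  let l := lam_fun lam in
  globally_reversible (P_mx lam) -> (forall k, (k <= N)%N -> 0 < l k) ->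
  l 0%N = 1 -> l 1%N < 1 -> l 1%N * (1 - l 1%N) = (l 1%N - l 2) * (1 + t) ->
  forall k, (k < N)%N -> l k * (1 - l 1%N) = (l k - l k.+1) * (1 + k%:R * t).
Proof.
move=> l glob lpos l0 l1 tE; elim=> [_|K IH KN].
  by rewrite l0 mul0r addr0; ring.
have {}IH := IH (ltnW KN).
have := four_cycle glob KN (lpos _ (ltnW KN)); rewrite -/l /= -/l l0.
have p0 := lpos 1%N (leq_trans (ltn0Sn K) (ltnW KN)).
have u0 : 0 < l K - l K.+1 by rewrite subr_gt0 lam_fun_decr -/l ?l0 // ltnW.
move: tE IH p0 u0 l1; rewrite -[K.+1%:R]natr1 -/l.
move: (l 1%N) (l 2) (l K) (l K.+1) (l K.+2) (K%:R) => p m a b c k.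
move=> tE IH p0 u0 q0 E.
have nz1 : (1 - p) * p != 0 by rewrite mulf_neq0 ?gt_eqF ?subr_gt0.
(* By [tE], $(1+t)(1-2p+m)=(1-p)(1-p+t)$; this eliminates [m] from [E], and $p(1-p)$ cancels. *)
have E1 : (1 - p + t) * (a - b) * (b - c) = (1 - p) * b * (a - b - (b - c)).
  apply: (mulfI nz1).
  have := congr1 ( *%R (1 + t)) E.
  have := congr1 ( *%R ((1 - p) * b * (a - b - (b - c)))) tE.
  have := congr1 ( *%R (p * (a - b) * (b - c))) tE.
  lra.
(* With $u=a-b$, $v=b-c$, [E1] gives $(1-p)bu=v((1-p)(u+b)+tu)$; here $u+b=a$, and [IH] turns the
   bracket into $u(1+(k+1)t)$. *)
apply: (mulfI (lt0r_neq0 u0)).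
have := congr1 ( *%R (a - b)) IH; have := congr1 ( *%R (b - c)) IH.
lra.
Qed.

(* Positivity of the factors [1 + k t] and [p + k t] is forced by the recursion. *)
Lemma polya_moments N (lam : 'rV[R]_N.+1) :
  let l := lam_fun lam in
  globally_reversible (P_mx lam) -> (2 <= N)%N ->
  (forall k, (k <= N)%N -> 0 < l k) -> l 0%N = 1 -> l 1%N < 1 ->
  exists t, [/\ forall k, (k < N)%N -> 0 < 1 + k%:R * t,
    forall k, (k < N)%N -> 0 < l 1%N + k%:R * t
    & forall k, (k <= N)%N -> l k = rising (l 1%N) t k / rising 1 t k].
Proof.
move=> l glob N2 lpos l0 l1.
have decr k : (k < N)%N -> 0 < l k - l k.+1.
  by move=> kN; rewrite subr_gt0 lam_fun_decr // -/l l0.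
have d1 := decr 1%N N2.
(* The solution of the recursion at [k = 1]. *)
pose t := l 1%N * (1 - l 1%N) / (l 1%N - l 2) - 1.
have tE : l 1%N * (1 - l 1%N) = (l 1%N - l 2) * (1 + t).
  by rewrite /t [1 + (_ - 1)]addrC subrK [RHS]mulrC divfK // gt_eqF.
have rec := polya_recursion glob lpos l0 l1 tE; rewrite -/l in rec.
have q0 : 0 < 1 - l 1%N by rewrite subr_gt0.
have T0 k : (k < N)%N -> 0 < 1 + k%:R * t.
  move=> kN; rewrite -(pmulr_rgt0 _ (decr k kN)) -rec //.
  by rewrite mulr_gt0 // lpos // ltnW.
have step k : (k < N)%N -> l k.+1 * (1 + k%:R * t) = l k * (l 1%N + k%:R * t).
  by move=> kN; have := rec k kN; lra.
have A0 k : (k < N)%N -> 0 < l 1%N + k%:R * t.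
  move=> kN; rewrite -(pmulr_rgt0 _ (lpos k (ltnW kN))) -step //.
  by rewrite mulr_gt0 ?T0 ?lpos.
exists t; split=> //; elim=> [_|k IH kN].
  by rewrite /rising !big_ord0 l0 divr1.
have Tk : rising 1 t k != 0.
  by rewrite gt_eqF // rising_gt0 // => i ik; apply: T0; apply: ltn_trans kN.
have nz : 1 + k%:R * t != 0 by rewrite gt_eqF ?T0.
apply: (mulIf nz); rewrite step // IH 1?ltnW // !risingS; field.
by rewrite nz Tk.
Qed.

(** * What accessibility of 0 implies for $\lambda$ *)

Lemma lam_fun_le N (lam : 'rV[R]_N.+1) k :
  stochastic (P_mx lam) -> (k < N)%N -> lam_fun lam k.+1 <= lam_fun lam k.
Proof.
move=> st kN; have := step_wt_ge0 k st kN.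
by rewrite step_wt_subdiag pmulr_rge0 ?ltr0Sn // subr_ge0.
Qed.

(** State 0 can be entered only from [N], with probability $\lambda_N$, so $\lambda_N>0$;
    monotonicity passes this on to the other entries. *)
Lemma lam_fun_pos N (lam : 'rV[R]_N.+1) k :
  involutive_walk (P_mx lam) -> (0 < N)%N ->
  (forall x z : 'I_N.+1, nat_of_ord z = 0%N -> accessible (P_mx lam) x z) ->
  (k <= N)%N -> 0 < lam_fun lam k.
Proof.
move=> [st _] N0 acc kN.
have top : 0 < lam_fun lam N.
  have N1 : lam_fun lam N = P_mx lam (inord N) ord0.
    by rewrite P_mxE inordK // subn0 step_wt_diag.
  rewrite lt_def N1 st.1 andbT -N1; apply/eqP => lN.
  have [[|j]] := acc (inord N) ord0 erefl.
    rewrite expr0 mxE -val_eqE /= inordK // gtn_eqF //; by rewrite ltxx.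
  rewrite exprSr mxE big1 ?ltxx // => z _; rewrite P_mxE subn0.
  have [zN|Nz] := ltnP z N; first by rewrite step_wt_gt ?mulr0.
  have -> : nat_of_ord z = N by have := ltn_ord z; lia.
  by rewrite step_wt_diag lN mulr0.
move: (N - k)%N (subnK kN) => d; elim: d k kN => [|d IH] k kN dk.
  by have -> : k = N by lia.
have kN' : (k < N)%N by lia.
by apply: lt_le_trans (lam_fun_le st kN'); apply: IH; lia.
Qed.

(** Otherwise [lam_fun_decr] excludes every strict decrease, $\lambda$ is constantly 1, and 0 cannot
    be reached from 1. *)
Lemma lam_fun1_lt1 N (lam : 'rV[R]_N.+1) :
  stochastic (P_mx lam) -> (2 <= N)%N ->
  (forall x z : 'I_N.+1, nat_of_ord z = 0%N -> accessible (P_mx lam) x z) ->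
  globally_reversible (P_mx lam) -> lam_fun lam 1 < 1.
Proof.
move=> st N2 acc glob; have l0 := lam_fun0 st.
rewrite ltNge; apply/negP => l1.
have lE k : (k <= N)%N -> lam_fun lam k = 1.
  elim: k => // k IH kN; apply/eqP.
  rewrite eq_le -[in X in X && _](IH (ltnW kN)) lam_fun_le //=.
  by rewrite -(IH (ltnW kN)) leNgt lam_fun_decr // l0 -leNgt.
have fE d y : (y + d.+1 <= N)%N -> fdiff (lam_fun lam) y d.+1 = 0.
  elim: d y => [|d IH] y yd; first by rewrite /= !lE ?subrr //; lia.
  by rewrite -[LHS]/(fdiff _ y d.+1 - fdiff _ y.+1 d.+1) !IH ?subrr //; lia.
(* Then P is the antidiagonal matrix, and the set of states {1, N - 1} is closed. *)
have PE (x z : 'I_N.+1) : (x + z != N)%N -> P_mx lam x z = 0.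
  move=> xz; rewrite P_mxE; have [zx|xz'] := ltnP x (N - z); first exact: step_wt_gt.
  have := ltn_ord x; have := ltn_ord z => zN xN.
  rewrite /step_wt; case D: (x - (N - z))%N => [|d]; first lia.
  by rewrite fE ?mulr0 //; lia.
have [j] := acc (inord 1) ord0 erefl.
suff H (z : 'I_N.+1) : z != 1%N :> nat -> z != N.-1 :> nat ->
    (P_mx lam ^+ j) (inord 1) z = 0.
  by rewrite H ?ltxx //=; lia.
elim: j z => [|j IH] z z1 zN.
  by rewrite expr0 mxE -val_eqE /= inordK ?[_ == val z]eq_sym ?(negbTE z1) //; lia.
rewrite exprSr mxE big1 // => y _.
have [yz|yz] := eqVneq (y + z)%N N; last by rewrite PE ?mulr0.
by rewrite IH ?mul0r //; lia.
Qed.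

(** * Matching Polya moments with the three families *)

Lemma weight_mx_of_proportional N (lam : 'rV[R]_N.+1) g (kappa : nat -> R) :
  stochastic (P_mx lam) -> (forall x, (x <= N)%N -> kappa x != 0) ->
  (forall x y, (y <= x <= N)%N -> g y x = kappa x * step_wt (lam_fun lam) x y) ->
  P_mx lam = weight_mx N.+1 g.
Proof.
move=> st k0 gE; apply/weight_mxE => x y yx.
have [_ xN] := andP yx.
rewrite (eq_bigr (fun i : 'I_x.+1 => kappa x * step_wt (lam_fun lam) x i)).
  by rewrite -mulr_sumr sum_step_wt_small // lam_fun0 // gE // mulr1 mulrAC
    divff ?mul1r // k0.
by move=> i _; rewrite gE // xN -ltnS ltn_ord.
Qed.

Lemma weight_mx_ratio N (lam : 'rV[R]_N.+1) g x y z :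
  P_mx lam = weight_mx N.+1 g -> (y <= x <= N)%N -> (z <= x <= N)%N ->
  g y x * step_wt (lam_fun lam) x z = g z x * step_wt (lam_fun lam) x y.
Proof. by move=> /weight_mxE E yx zx; rewrite !E // !mulrA [g y x * _]mulrC. Qed.

Lemma binr0 (r : R) : binr r 0 = 1.
Proof. by rewrite /binr big_ord0 divr1. Qed.

Lemma binr1 (r : R) : binr r 1 = r.
Proof. by rewrite /binr big_ord_recl big_ord0 subr0 divr1 mulr1. Qed.

Lemma binr2 (r : R) : binr r 2 = r * (r - 1) / 2.
Proof. by rewrite /binr !big_ord_recl big_ord0 subr0 mulr1. Qed.

(** Once the product is reversed, its factor [i] is $(p+it)/t$. *)
Lemma binr_rising p t k : 0 < t ->
  binr (k%:R + (p / t - 1)) k = rising p t k / (t ^+ k * k`!%:R).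
Proof.
move=> t0; rewrite /binr invfM mulrA; congr (_ / _).
rewrite -[k in t ^+ k]card_ord -prodr_const -prodf_div.
rewrite (reindex_inj rev_ord_inj); apply: eq_bigr => i _ /=.
rewrite natrB ?ltn_ord // -natr1; field; exact: lt0r_neq0.
Qed.

Lemma binr_rising_opp p t k : t < 0 ->
  binr (p / - t + 1 - 1) k = rising p t k / ((- t) ^+ k * k`!%:R).
Proof.
move=> t0; rewrite addrK /binr invfM mulrA; congr (_ / _).
rewrite -[k in _ ^+ k]card_ord -prodr_const -prodf_div.
by apply: eq_bigr => i _ /=; field; rewrite ltr0_neq0.
Qed.

Section Polya.
Variables (N : nat) (lam : 'rV[R]_N.+1) (p t : R).
Hypotheses (st : stochastic (P_mx lam)) (p01 : 0 < p < 1).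
Hypothesis T_gt0 : forall k, (k < N)%N -> 0 < 1 + k%:R * t.
Hypothesis lamE : forall k, (k <= N)%N -> lam_fun lam k = rising p t k / rising 1 t k.

Let rising1_gt0 k : (k <= N)%N -> 0 < rising 1 t k.
Proof. by move=> kN; apply: rising_gt0 => i ik; apply: T_gt0; apply: leq_trans kN. Qed.

Lemma step_wt_rising x y : (y <= x <= N)%N ->
  step_wt (lam_fun lam) x y =
  'C(x, y)%:R * (rising p t y * rising (1 - p) t (x - y) / rising 1 t x).
Proof.
by move=> /andP[yx xN]; rewrite /step_wt (fdiff_rising rising1_gt0 lamE) subnKC.
Qed.

(** Here [s] stands for $|t|$. Since $\binom xy\,y!\,(x-y)!=x!$ and $s^ys^{x-y}=s^x$, [g] differs
    from the step weights by a factor depending on [x] alone. *)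
Let weight_mx_of_rising g s : 0 < s ->
  (forall x y, (y <= x <= N)%N ->
    g y x = rising p t y / (s ^+ y * y`!%:R) *
            (rising (1 - p) t (x - y) / (s ^+ (x - y) * (x - y)`!%:R))) ->
  P_mx lam = weight_mx N.+1 g.
Proof.
move=> s0 gE.
have F k : k`!%:R != 0 :> R by rewrite pnatr_eq0 gtn_eqF ?fact_gt0.
have s_neq0 := lt0r_neq0 s0.
apply: (@weight_mx_of_proportional _ _ _
  (fun x => rising 1 t x / (s ^+ x * x`!%:R))) => // [x xN|x y yx].
  by rewrite mulf_neq0 ?invr_neq0 ?mulf_neq0 ?expf_neq0 // lt0r_neq0 ?rising1_gt0.
rewrite gE // step_wt_rising //; case/andP: yx => yx xN.
have T := rising1_gt0 xN.
rewrite -[X in _ = _ / (s ^+ X * _) * _](subnKC yx) exprD -(bin_fact yx) !natrM.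
have B : 'C(x, y)%:R != 0 :> R by rewrite pnatr_eq0 gtn_eqF ?bin_gt0.
by field; rewrite !F !expf_neq0 // B gt_eqF.
Qed.

Lemma weight_mx_gamma_ab : 0 < t ->
  P_mx lam = weight_mx N.+1 (gamma_ab (p / t - 1) ((1 - p) / t - 1)).
Proof.
move=> t0; apply: (weight_mx_of_rising t0) => x y _.
by rewrite /gamma_ab [_ - 1 + (x - y)%:R]addrC !binr_rising.
Qed.

Lemma weight_mx_delta_ab : t < 0 ->
  P_mx lam = weight_mx N.+1 (delta_ab (p / - t + 1) ((1 - p) / - t + 1)).
Proof.
move=> t0; have s0 : 0 < - t by rewrite oppr_gt0.
by apply: (weight_mx_of_rising s0) => x y _; rewrite /delta_ab !binr_rising_opp.
Qed.

(** At $t=0$ row [x] of [H_mx] is the binomial distribution with parameter [p], and [c] is the odds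
    $(1-p)/p$. *)
Lemma weight_mx_gamma_c : t = 0 -> P_mx lam = weight_mx N.+1 (gamma_c ((1 - p) / p)).
Proof.
move=> t0; have [p0 p1] := andP p01.
have rE r k : rising r t k = r ^+ k.
  rewrite /rising t0 -[k in _ ^+ k]card_ord -prodr_const.
  by apply: eq_bigr => i _; rewrite mulr0 addr0.
apply: (@weight_mx_of_proportional _ _ _ (fun x => (p ^+ x)^-1)) => // [x xN|x y yx].
  by rewrite invr_eq0 expf_neq0 ?lt0r_neq0.
rewrite step_wt_rising // !rE expr1n /gamma_c expr_div_n.
case/andP: yx => yx _; rewrite -[X in _ = (p ^+ X)^-1 * _](subnKC yx) exprD.
by field; rewrite !expf_neq0 ?lt0r_neq0.
Qed.

(* The entries of column 0 of H are nonnegative, so the first factor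
   [1 - p + i t] that fails to be positive vanishes, making [b' - 1] the
   integer [i]. *)
Lemma delta_b_range : t < 0 ->
  N.+1%:R - 1 < (1 - p) / - t + 1 \/
  ((1 - p) / - t + 1 \is a Num.nat /\ 2 <= (1 - p) / - t + 1).
Proof.
move=> t0; have s0 : 0 < - t by rewrite oppr_gt0.
have [p0 p1] := andP p01.
have [|] := boolP [forall i : 'I_N, 0 < 1 - p + i%:R * t].
  move=> /forallP H; left; rewrite -natr1 addrK.
  have [N0|Npos] := posnP N.
    by rewrite N0 addr_gt0 ?divr_gt0 ?subr_gt0.
  (* The factor of index $N-1$ is the sharpest: it says $(1-p)/(-t)>N-1$. *)
  have /= := H (Ordinal (etrans (congr1 (leq^~ N) (prednK Npos)) (leqnn N))).
  rewrite -[N in N%:R < _](prednK Npos) -natr1 ltrD2r.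
  by rewrite ltr_pdivlMr // mulrN; lra.
case/forallPn => i0 Hi0; right.
have ex : exists i, 1 - p + i%:R * t <= 0 by exists i0; rewrite leNgt.
case: (ex_minnP ex) => i it imin.
have iN : (i < N)%N.
  by apply: leq_ltn_trans (ltn_ord i0); apply: imin; rewrite leNgt.
(* The factor of index 0 is $1-p>0$; hence $b'=i+1\ge2$. *)
have i0' : (0 < i)%N by case: i it {imin iN} => // ; rewrite mul0r addr0; lra.
have /eqP E : 1 - p + i%:R * t == 0.
  rewrite eq_le it /=.
  have := step_wt_ge0 0 st iN.
  rewrite step_wt_rising ?iN // bin0 mul1r subn0 {1}/rising big_ord0 mul1r.
  rewrite risingS -mulrA pmulr_rge0.
    by rewrite pmulr_lge0 // invr_gt0 rising1_gt0.
  by apply: rising_gt0 => j ji; rewrite ltNge; apply: contraL ji => /imin;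
    rewrite -leqNgt.
have -> : (1 - p) / - t + 1 = i.+1%:R.
  have -> : 1 - p = i%:R * - t by lra.
  by rewrite mulfK ?lt0r_neq0 // natr1.
by rewrite natr_nat (ler_nat R 2).
Qed.
End Polya.

(** * Uniqueness of the parameters *)

(** A linear system in [(A, B)]: any solution satisfies $B(pw-2zq)=-eqw\ne0$, so the determinant is
    nonzero. It serves $\gamma^{(a,b)}$ with $e=1$ and $\delta^{(a',b')}$ with $e=-1$. *)
Lemma pair_of_ratios_inj (A B A' B' e p q w z : R) :
  e != 0 -> q != 0 -> w != 0 ->
  A * q = B * p -> (A + e) * w = 2 * B * z ->
  A' * q = B' * p -> (A' + e) * w = 2 * B' * z -> A = A' /\ B = B'.
Proof.
move=> e0 q0 w0 E1 E2 E3 E4.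
have D0 : p * w - 2 * z * q != 0.
  have : B * (p * w - 2 * z * q) != 0.
    have -> : B * (p * w - 2 * z * q) = - (e * w * q).
      have := congr1 ( *%R w) E1; have := congr1 ( *%R q) E2; lra.
    by rewrite oppr_eq0 !mulf_neq0.
  by apply: contraNneq => ->; rewrite mulr0.
have BB : B = B'.
  apply: (mulIf D0).
  have := congr1 ( *%R w) E1; have := congr1 ( *%R q) E2.
  have := congr1 ( *%R w) E3; have := congr1 ( *%R q) E4; lra.
by split=> //; apply: (mulIf q0); rewrite E1 E3 BB.
Qed.

Section Uniqueness.
Variables (N : nat) (lam : 'rV[R]_N.+1).
Hypotheses (N2 : (2 <= N)%N).
Let l := lam_fun lam.
Hypotheses (l0 : l 0%N = 1) (p0 : 0 < l 1%N) (p1 : l 1%N < 1) (l21 : l 2 < l 1%N).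

Let q_neq0 : 1 - l 1%N != 0. Proof. by rewrite subr_eq0 gt_eqF. Qed.
Let w_neq0 : 2 * (l 1%N - l 2) != 0.
Proof. by rewrite mulf_neq0 ?pnatr_eq0 // subr_eq0 gt_eqF. Qed.

(** Diagonal against subdiagonal in rows 1 and 2 gives two equations, enough for two parameters. *)
Let ratios g : P_mx lam = weight_mx N.+1 g ->
  g 1 1 * (1 - l 1) = g 0 1 * l 1 /\ g 2 2 * (2 * (l 1%N - l 2)) = g 1 2 * l 2.
Proof.
move=> E.
have := @weight_mx_ratio _ _ _ 1 1 0 E; have := @weight_mx_ratio _ _ _ 2 2 1 E.
rewrite !step_wt_subdiag !step_wt_diag -/l l0 mul1r N2 (ltnW N2).
by move=> /(_ isT isT) -> /(_ isT isT) ->.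
Qed.

Lemma gamma_c_unique c c' :
  P_mx lam = weight_mx N.+1 (gamma_c c) -> P_mx lam = weight_mx N.+1 (gamma_c c') ->
  c = c'.
Proof.
move=> /ratios[E _] /ratios[E' _].
move: E E'; rewrite /gamma_c !bin0 !binn !subnn !expr0 !subn0 !expr1 !mul1r => -> E.
exact: (mulIf (lt0r_neq0 p0)) E.
Qed.

Let gamma_ab_ratios a b : -1 < a -> P_mx lam = weight_mx N.+1 (gamma_ab a b) ->
  (a + 1) * (1 - l 1%N) = (b + 1) * l 1%N /\
  (a + 1 + 1) * (2 * (l 1%N - l 2)) = 2 * (b + 1) * l 2.
Proof.
move=> a1 /ratios[]; rewrite /gamma_ab !subnn !subn0 subSnn !binr0 !binr1 !binr2.
rewrite !mulr1 !mul1r [1 + a]addrC => E1 E2; split=> //.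
have a0 : a + 1 != 0 by rewrite gt_eqF //; lra.
(* Both sides of the row 2 equation carry the factor $a+1$. *)
by apply: (mulfI a0); lra.
Qed.

Lemma gamma_ab_unique a b a' b' : -1 < a -> -1 < a' ->
  P_mx lam = weight_mx N.+1 (gamma_ab a b) ->
  P_mx lam = weight_mx N.+1 (gamma_ab a' b') -> a = a' /\ b = b'.
Proof.
move=> a1 a1' /(gamma_ab_ratios a1)[E1 E2] /(gamma_ab_ratios a1')[E3 E4].
have [] := pair_of_ratios_inj (oner_neq0 R) q_neq0 w_neq0 E1 E2 E3 E4.
by move=> /addIr -> /addIr ->.
Qed.

Let delta_ab_ratios a b : N.+1%:R - 1 < a -> P_mx lam = weight_mx N.+1 (delta_ab a b) ->
  (a - 1) * (1 - l 1%N) = (b - 1) * l 1%N /\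
  (a - 1 + -1) * (2 * (l 1%N - l 2)) = 2 * (b - 1) * l 2.
Proof.
move=> aN /ratios[]; rewrite /delta_ab !subnn !subn0 subSnn !binr0 !binr1 !binr2.
rewrite !mulr1 !mul1r => E1 E2; split=> //.
have a0 : a - 1 != 0.
  have : 2 <= N%:R :> R by rewrite (ler_nat R 2).
  by move: aN; rewrite -natr1 => aN N2'; rewrite gt_eqF //; lra.
by apply: (mulfI a0); lra.
Qed.

Lemma delta_ab_unique a b a' b' : N.+1%:R - 1 < a -> N.+1%:R - 1 < a' ->
  P_mx lam = weight_mx N.+1 (delta_ab a b) ->
  P_mx lam = weight_mx N.+1 (delta_ab a' b') -> a = a' /\ b = b'.
Proof.
move=> a1 a1' /(delta_ab_ratios a1)[E1 E2] /(delta_ab_ratios a1')[E3 E4].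
have m1 : -1 != 0 :> R by rewrite oppr_eq0 oner_neq0.
have [] := pair_of_ratios_inj m1 q_neq0 w_neq0 E1 E2 E3 E4.
by move=> /addIr -> /addIr ->.
Qed.
End Uniqueness.

End Differences.

(** * The equivalence, with the family selected by the sign of [t] *)

Theorem theorem1p8 (R : realType) (n : nat) (n_ge3 : (3 <= n)%N)
    (lam : 'rV[R]_n)
    (walk : involutive_walk (P_mx lam))
    (acc0 : forall x z : 'I_n, nat_of_ord z = 0%N -> accessible (P_mx lam) x z) :
  globally_reversible (P_mx lam) <->
  [\/ exists! ab : R * R,
        [/\ -1 < ab.1, -1 < ab.2
          & P_mx lam = weight_mx n (gamma_ab ab.1 ab.2)],
      exists! c : R, 0 < c /\ P_mx lam = weight_mx n (gamma_c c)
    | exists! ab : R * R,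
        [/\ n%:R - 1 < ab.1,
            n%:R - 1 < ab.2 \/ (ab.2 \is a Num.nat /\ 2 <= ab.2)
          & P_mx lam = weight_mx n (delta_ab ab.1 ab.2)]].
Proof.
case: n n_ge3 lam walk acc0 => // N N2 lam walk acc; have [st _] := walk.
split; last first.
  case=> [[[a b] [[/= a1 b1 E] _]]|[c [[c0 E] _]]|[[a b] [[/= aN bN E] _]]].
  - exact: gamma_ab_globally_reversible E.
  - exact: gamma_c_globally_reversible E.
  - exact: delta_ab_globally_reversible E.
move=> glob; have l0 := lam_fun0 st.
have lpos k (kN : (k <= N)%N) := lam_fun_pos walk (ltnW N2) acc kN.
have p1 := lam_fun1_lt1 st N2 acc glob; have p0 := lpos 1%N (ltnW N2).
have l21 : lam_fun lam 2 < lam_fun lam 1 by rewrite lam_fun_decr // l0.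
have [t [T0 A0 lE]] := polya_moments glob N2 lpos l0 p1.
have p01 : 0 < lam_fun lam 1 < 1 by rewrite p0.
have q0 : 0 < 1 - lam_fun lam 1 by rewrite subr_gt0.
case: (ltrgtP t 0) => [t0|t0|t0].
- have E := weight_mx_delta_ab st T0 lE t0.
  (* Positivity of $p+(N-1)t$, with $p=\lambda_1$, is exactly $p/(-t)>N-1$. *)
  have aD : N.+1%:R - 1 < lam_fun lam 1 / - t + 1.
    have s0 : 0 < - t by rewrite oppr_gt0.
    have := A0 N.-1; rewrite prednK ?leqnn => [/(_ isT) AN|]; last exact: ltnW.
    rewrite -natr1 addrK -[N in N%:R]prednK; last exact: ltnW.
    by rewrite -natr1 ltrD2r ltr_pdivlMr // mulrN; lra.
  apply: Or33; eexists (_, _); split.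
    by split; [exact: aD|exact: delta_b_range p01 T0 lE t0|exact: E].
  move=> [a b] [/= aN _ E'].
  by have [<- <-] := delta_ab_unique N2 l0 p1 l21 aD aN E E'.
- have E := weight_mx_gamma_ab st T0 lE t0.
  have pos r : 0 < r -> -1 < r / t - 1 by move=> r0; rewrite ltrBrDl subrr divr_gt0.
  apply: Or31; eexists (_, _); split; first by split; [exact: pos p0|exact: pos q0|exact: E].
  move=> [a b] [/= a1 _ E'].
  by have [<- <-] := gamma_ab_unique N2 l0 p1 l21 (pos _ p0) a1 E E'.
- have E := weight_mx_gamma_c st p01 T0 lE t0.
  apply: Or32; eexists; split; first by split; [exact: divr_gt0 q0 p0|exact: E].
  by move=> c [_ E']; exact: gamma_c_unique E E'.
Qed.
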